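(* Let $A=\{x_1,x_2\}$ be an alphabet of two variables and let $x$ be a further variable. For every positive integer $n$, $$\sum_{k=0}^{n}\binom{n}{k}(x_1-x_2)^{n-k}\left(2^k\phi_k(x_1+x_2)+2(x_1+x_2)^k\right)E_{n-k}(x)=2\left(\bigl(x_1+x_2+(x_1-x_2)x\bigr)^{n}+\bigl(2x_2+(x_1-x_2)x\bigr)^{n}\right).$$
   Context: Here $x_1,x_2,x$ are commuting variables (indeterminates) and identities are in the field of rational functions in them. The notation $\phi_n(x_1+x_2)$ denotes the function of the alphabet $\{x_1,x_2\}$ (not of the sum) given by $\phi_n(x_1+x_2)=x_1^n+x_2^n$ for $n\ge 0$; the expression $(x_1+x_2)^k$ is the ordinary power of the sum. The Euler polynomials $E_n(x)$ are defined by $\sum_{n\ge 0}E_n(x)\frac{z^n}{n!}=\frac{2e^{xz}}{e^z+1}$. *)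

(* Defs.v *)
From mathcomp Require Import all_boot all_order all_algebra.
From mathcomp Require Import mpoly.

Set Implicit Arguments.
Unset Strict Implicit.
Unset Printing Implicit Defensive.

Import GRing.Theory.
Local Open Scope ring_scope.

(* A formal power series in z over R is given by its coefficients: f stands
   for the sum of the f n * z ^ n. *)
Definition fps (R : Type) := nat -> R.

Definition fps_const (R : comUnitRingType) (c : R) : fps R :=
  fun n => if n == 0%N then c else 0.

Definition fps_add (R : comUnitRingType) (f g : fps R) : fps R :=
  fun n => f n + g n.

Definition fps_mul (R : comUnitRingType) (f g : fps R) : fps R :=
  fun n => \sum_(k < n.+1) f k * g (n - k)%N.

(* The first n coefficients of 1 / g, each one obtained from the previous ones
   by solving g * (1 / g) = 1 in degree m. *)
Fixpoint fps_inv_seq (R : comUnitRingType) (g : fps R) (n : nat) : seq R :=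
  if n is m.+1 then
    let s := fps_inv_seq g m in
    rcons s ((g 0%N)^-1 *
             (fps_const 1 m - \sum_(k < m) s`_k * g (m - k)%N))
  else [::].

(* The inverse of g, meaningful when g 0 is a unit: see fps_mulVf. *)
Definition fps_inv (R : comUnitRingType) (g : fps R) : fps R :=
  fun n => (fps_inv_seq g n.+1)`_n.

Definition fps_div (R : comUnitRingType) (f g : fps R) : fps R :=
  fps_mul f (fps_inv g).

(* exp (c * z); the factorials are units of R when R is an algebra over a
   field of characteristic 0. *)
Definition fps_exp (R : comUnitRingType) (c : R) : fps R :=
  fun n => c ^+ n / (n`!)%:R.

(* 2 * exp (x * z) / (exp z + 1), the variable x being 'X. *)
Definition euler_gf (F : fieldType) : fps {poly F} :=
  fps_div (fps_mul (fps_const 2) (fps_exp 'X))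
          (fps_add (fps_exp 1) (fps_const 1)).

(* E_n(x), for F of characteristic 0: see euler_polyP. *)
Definition euler_poly (F : fieldType) (n : nat) : {poly F} :=
  (n`!)%:R * euler_gf F n.

Lemma size_fps_inv_seq (R : comUnitRingType) (g : fps R) (n : nat) :
  size (fps_inv_seq g n) = n.
Proof. by elim: n => //= n IHn; rewrite size_rcons IHn. Qed.

Lemma nth_fps_inv_seq (R : comUnitRingType) (g : fps R) (n k : nat) :
  (k < n)%N -> (fps_inv_seq g n)`_k = fps_inv g k.
Proof.
elim: n => // n IHn; rewrite ltnS leq_eqVlt => /orP[/eqP-> //|lt_kn].
by rewrite /= nth_rcons size_fps_inv_seq lt_kn IHn.
Qed.

Lemma fps_mulVf (R : comUnitRingType) (g : fps R) :
  g 0%N \is a GRing.unit -> fps_mul (fps_inv g) g =1 fps_const 1.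
Proof.
move=> Ug n; rewrite /fps_mul big_ord_recr /= subnn {2}/fps_inv /=.
rewrite nth_rcons size_fps_inv_seq ltnn eqxx mulrAC mulVr // mul1r addrC.
rewrite -addrA -[RHS]addr0; congr (_ + _); rewrite addrC; apply/eqP.
rewrite subr_eq0; apply/eqP/eq_bigr => k _.
by rewrite nth_fps_inv_seq.
Qed.

Lemma pchar0_natr_unit (F : fieldType) (n : nat) :
  [pchar F] =i pred0 -> (0 < n)%N -> (n%:R : {poly F}) \is a GRing.unit.
Proof.
move=> charF n_gt0; rewrite -polyC_natr poly_unitE coefC size_polyC /=.
by rewrite unitfE ((pcharf0P F).1 charF) -lt0n n_gt0.
Qed.

Lemma euler_denom_unit (F : fieldType) :
  [pchar F] =i pred0 ->
  fps_add (fps_exp (1 : {poly F})) (fps_const 1) 0%N \is a GRing.unit.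
Proof.
move=> charF; rewrite /fps_add /fps_exp /fps_const /= expr0 fact0 divr1.
exact: (@pchar0_natr_unit F 2).
Qed.

Lemma euler_polyP (F : fieldType) (n : nat) :
  [pchar F] =i pred0 -> euler_poly F n / (n`!)%:R = euler_gf F n.
Proof.
move=> charF; rewrite /euler_poly mulrAC mulrV ?mul1r //.
by apply: pchar0_natr_unit; rewrite ?fact_gt0.
Qed.

(* phi_n(a + b): a function of the alphabet {a, b}, not of the sum a + b. *)
Definition phi (R : comNzRingType) (n : nat) (a b : R) : R := a ^+ n + b ^+ n.


Definition ratfunC (F : fieldType) (c : F) : {fraction {mpoly F[3]}} :=
  tofrac c%:MP.

Definition ratfunX (F : fieldType) (i : 'I_3) : {fraction {mpoly F[3]}} :=
  tofrac 'X_i.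

(* The value at y of the polynomial E_n, its coefficients being viewed as
   constant rational functions. *)
Definition euler_at (F : fieldType) (n : nat) (y : {fraction {mpoly F[3]}}) :
    {fraction {mpoly F[3]}} :=
  (map_poly (@ratfunC F) (euler_poly F n)).[y].

(* Main.v *)
(* With d = x1 - x2, the left-hand side is n! times the coefficient of z^n in
   (e^(x1 z) + e^(x2 z))^2 * 2 e^(x d z) / (e^(d z) + 1), and
   (e^(x1 z) + e^(x2 z))^2 = (e^(d z) + 1) (e^(2 x2 z) + e^((x1 + x2) z)). *)
Require Import Defs.
From mathcomp Require Import all_boot all_order all_algebra.
From mathcomp Require Import mpoly ring.

Set Implicit Arguments.
Unset Strict Implicit.
Unset Printing Implicit Defensive.

Import GRing.Theory.
Local Open Scope ring_scope.

Section FormalPowerSeries.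

Variable R : comUnitRingType.
Implicit Types (f g h : fps R) (a b c : R).

(** Series are compared pointwise by [=1], so rewriting a factor of a product goes through this
    congruence. *)
Lemma eq_fps_mul f f' g g' :
  f =1 f' -> g =1 g' -> fps_mul f g =1 fps_mul f' g'.
Proof. by move=> eq_f eq_g n; apply: eq_bigr => k _; rewrite eq_f eq_g. Qed.

(** The coefficient of z^n in a product involves only coefficients of index at most n, so truncation
    loses nothing. Commutativity and associativity are thereby inherited from [{poly R}]. *)
Lemma fps_mul_coef_poly f g N n : (n < N)%N ->
  fps_mul f g n = (\poly_(i < N) f i * \poly_(i < N) g i)`_n.
Proof.
move=> lt_nN; rewrite coefM; apply: eq_bigr => k _; rewrite !coef_poly.
by rewrite (leq_ltn_trans (leq_ord k)) // (leq_ltn_trans (leq_subr k n)).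
Qed.

Lemma fps_mulC f g : fps_mul f g =1 fps_mul g f.
Proof. by move=> n; rewrite !(@fps_mul_coef_poly _ _ n.+1) // mulrC. Qed.

Lemma fps_mulA f g h : fps_mul f (fps_mul g h) =1 fps_mul (fps_mul f g) h.
Proof.
move=> n; pose t (u : fps R) := \poly_(i < n.+1) u i.
transitivity ((t f * (t g * t h))`_n).
  rewrite coefM; apply: eq_bigr => k _; rewrite coef_poly ltn_ord.
  by rewrite (@fps_mul_coef_poly _ _ n.+1) // ltnS leq_subr.
rewrite mulrA coefM; apply: eq_bigr => k _; rewrite coef_poly ltnS leq_subr.
by rewrite (@fps_mul_coef_poly _ _ n.+1).
Qed.

Lemma fps_mulDl f g h :
  fps_mul (fps_add f g) h =1 fps_add (fps_mul f h) (fps_mul g h).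
Proof.
by move=> n; rewrite /fps_add -big_split; apply: eq_bigr => k _; rewrite mulrDl.
Qed.

Lemma fps_mulDr f g h :
  fps_mul f (fps_add g h) =1 fps_add (fps_mul f g) (fps_mul f h).
Proof.
by move=> n; rewrite /fps_add -big_split; apply: eq_bigr => k _; rewrite mulrDr.
Qed.

Lemma fps_mul_constl c f n : fps_mul (fps_const c) f n = c * f n.
Proof.
rewrite /fps_mul big_ord_recl /= subn0 big1 ?addr0 // => k _.
by rewrite /fps_const /= mul0r.
Qed.

Lemma fps_mul_constr f c n : fps_mul f (fps_const c) n = f n * c.
Proof. by rewrite fps_mulC fps_mul_constl mulrC. Qed.

Lemma fps_divK f g : g 0%N \is a GRing.unit -> fps_mul (fps_div f g) g =1 f.
Proof.
move=> Ug n; rewrite -fps_mulA.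
by rewrite (eq_fps_mul (frefl _) (fps_mulVf Ug)) fps_mul_constr mulr1.
Qed.

(** The substitution of c * z for z is multiplicative. *)
Lemma fps_mul_scale c f g n :
  fps_mul (fun k => c ^+ k * f k) (fun k => c ^+ k * g k) n
  = c ^+ n * fps_mul f g n.
Proof.
rewrite /fps_mul big_distrr; apply: eq_bigr => k _ /=.
by rewrite mulrACA -exprD subnKC // leq_ord.
Qed.

Hypothesis Ufact : forall n, (n`!)%:R \is a @GRing.unit R.

Lemma natr_bin_fact n k : (k <= n)%N ->
  'C(n, k)%:R / (n`!)%:R = (k`!)%:R^-1 * ((n - k)`!)%:R^-1 :> R.
Proof.
move=> le_kn; rewrite -invrM // -natrM mulnC.
have Ukn : (k`! * (n - k)`!)%:R \is a @GRing.unit R by rewrite natrM unitrM !Ufact.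
by apply: (mulIr Ukn); rewrite mulVr // mulrAC -natrM bin_fact // divrr.
Qed.

Lemma fps_expD a b : fps_mul (fps_exp a) (fps_exp b) =1 fps_exp (a + b).
Proof.
(* [exprDn] puts the exponent n - k on the first summand; the swap gives k to a, as in the
   product. *)
move=> n; rewrite /fps_exp addrC exprDn big_distrl; apply: eq_bigr => k _ /=.
rewrite -[_ *+ 'C(n, k)]mulr_natr -[RHS]mulrA natr_bin_fact ?leq_ord //.
by rewrite [X in _ = X * _]mulrC mulrACA.
Qed.

(** Binomial convolution of sequences is multiplication of their exponential generating
    functions. *)
Lemma fps_mul_binomial (u v : nat -> R) n :
  \sum_(k < n.+1) 'C(n, k)%:R * u k * v (n - k)%N
  = (n`!)%:R * fps_mul (fun k => u k / (k`!)%:R) (fun k => v k / (k`!)%:R) n.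
Proof.
rewrite big_distrr; apply: eq_bigr => k _ /=.
rewrite mulrACA -natr_bin_fact ?leq_ord // -mulrA.
by rewrite [RHS]mulrC -[RHS]mulrA divrK // mulrC.
Qed.

End FormalPowerSeries.

Lemma fps_mul_rmorph (R S : comUnitRingType) (h : {rmorphism R -> S})
    (f g : fps R) (n : nat) :
  h (fps_mul f g n) = fps_mul (h \o f) (h \o g) n.
Proof. by rewrite rmorph_sum; apply: eq_bigr => k _; rewrite rmorphM. Qed.

Lemma euler_gf_mul (F : fieldType) : [pchar F] =i pred0 ->
  fps_mul (@euler_gf F) (fps_add (fps_exp 1) (fps_const 1))
    =1 fun n => 2 * fps_exp 'X n.
Proof.
move=> charF n; rewrite fps_divK ?fps_mul_constl //.
exact: euler_denom_unit.
Qed.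

Section EulerSum.

Variables (F : fieldType) (S : comUnitRingType) (h : {rmorphism {poly F} -> S}).
Hypothesis charF : [pchar F] =i pred0.

(** Factorials are units in [{poly F}], and [h] preserves units. *)
Lemma rmorph_fact_unit n : (n`!)%:R \is a @GRing.unit S.
Proof.
by rewrite -(rmorph_nat h) rmorph_unit // pchar0_natr_unit // fact_gt0.
Qed.

(** This is the image under [h] of the defining equation of the Euler series, with d * z substituted
    for z. The denominator stays multiplied out, so nothing is inverted in terms of d. *)
Lemma euler_gf_rmorph_mul (d : S) :
  fps_mul (fps_add (fps_exp d) (fps_const 1))
          (fun n => d ^+ n * h (euler_gf F n))
    =1 fun n => 2 * fps_exp (h 'X * d) n.
Proof.
move=> n; rewrite fps_mulC.
(* The summand 1 is unchanged by the substitution, since it lives in degree 0, where d ^+ 0 = 1. *)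
have eqD : fps_add (fps_exp d) (fps_const 1)
    =1 fun k => d ^+ k * h (fps_add (fps_exp 1) (fps_const 1) k).
  move=> k; rewrite /fps_add /fps_exp /fps_const rmorphD expr1n mul1r.
  rewrite rmorphV ?rmorph_nat ?pchar0_natr_unit ?fact_gt0 // mulrDr.
  by case: k => [|k] /=; rewrite ?rmorph1 ?rmorph0 ?mulr1 ?mulr0.
rewrite (eq_fps_mul (frefl _) eqD) fps_mul_scale.
rewrite -(fps_mul_rmorph h (@euler_gf F)) euler_gf_mul // /fps_exp rmorphM.
rewrite rmorph_nat rmorphM rmorphV ?pchar0_natr_unit ?fact_gt0 //.
by rewrite rmorph_nat rmorphXn exprMn; ring.
Qed.

Lemma euler_sum (x1 x2 : S) n :
  \sum_(k < n.+1)
     'C(n, k)%:R * (2 ^+ k * phi k x1 x2 + 2 * (x1 + x2) ^+ k)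
       * ((x1 - x2) ^+ (n - k) * h (euler_poly F (n - k)))
  = 2 * ((x1 + x2 + (x1 - x2) * h 'X) ^+ n
         + (2 * x2 + (x1 - x2) * h 'X) ^+ n).
Proof.
have Ufact := rmorph_fact_unit; set d := x1 - x2.
rewrite (fps_mul_binomial Ufact (fun k => 2 ^+ k * phi k x1 x2 + 2 * (x1 + x2) ^+ k)
           (fun k => d ^+ k * h (euler_poly F k))).
(* The product of [A] and [B] is (e^(x1 z) + e^(x2 z))^2, and [B] is the denominator of the Euler
   series at d * z. *)
pose A : fps S := fps_add (fps_exp (x1 + x2)) (fps_exp (2 * x2)).
pose B : fps S := fps_add (fps_exp d) (fps_const 1).
have eqAB : (fun k => (2 ^+ k * phi k x1 x2 + 2 * (x1 + x2) ^+ k) / (k`!)%:R)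
    =1 fps_mul A B.
  move=> k; rewrite fps_mulDl /fps_add !fps_mulDr /fps_add !fps_mul_constr.
  rewrite !fps_expD // /phi mulrDr -!exprMn /fps_exp.
  (* The four exponents of the product are 2 x1, 2 x2 and twice x1 + x2; the repeated one yields the
     term 2 * (x1 + x2) ^+ k. *)
  have -> : x1 + x2 + d = 2 * x1 by rewrite /d; ring.
  have -> : 2 * x2 + d = x1 + x2 by rewrite /d; ring.
  by ring.
have eqE : (fun k => d ^+ k * h (euler_poly F k) / (k`!)%:R)
    =1 fun k => d ^+ k * h (euler_gf F k).
  by move=> k; rewrite rmorphM rmorph_nat mulrCA mulrAC mulrV // mul1r.
(* Reassociating brings [B] next to the Euler series, where it cancels the denominator. *)
rewrite (eq_fps_mul eqAB eqE) -fps_mulA.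
rewrite (eq_fps_mul (frefl _) (euler_gf_rmorph_mul d)).
have -> : fps_mul A (fun k => 2 * fps_exp (h 'X * d) k) n
    = 2 * fps_mul A (fps_exp (h 'X * d)) n.
  by rewrite /fps_mul big_distrr; apply: eq_bigr => k _; rewrite /= mulrCA.
rewrite fps_mulDl /fps_add !fps_expD // /fps_exp -mulrDl.
by rewrite mulrCA [_%:R * (_ / _)]mulrC divrK // [h 'X * d]mulrC.
Qed.

End EulerSum.

Theorem theorem12 (F : fieldType) (charF : [pchar F] =i pred0)
    (n : nat) (n_gt0 : (0 < n)%N) :
  let x1 : {fraction {mpoly F[3]}} := ratfunX F (inord 0) in
  let x2 : {fraction {mpoly F[3]}} := ratfunX F (inord 1) in
  let x : {fraction {mpoly F[3]}} := ratfunX F (inord 2) in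
  \sum_(0 <= k < n.+1)
     'C(n, k)%:R * (x1 - x2) ^+ (n - k)
       * (2 ^+ k * phi k x1 x2 + 2 * (x1 + x2) ^+ k)
       * euler_at (n - k) x
  = 2 * ((x1 + x2 + (x1 - x2) * x) ^+ n + (2 * x2 + (x1 - x2) * x) ^+ n).
Proof.
move=> x1 x2 x.
pose i : {rmorphism F -> {fraction {mpoly F[3]}}} :=
  @tofrac _ \o @mpolyC 3 F.
(* [h] embeds the coefficients as constants and evaluates at [x], so [h] of an Euler polynomial is
   [euler_at] by conversion. *)
pose h : {rmorphism {poly F} -> {fraction {mpoly F[3]}}} :=
  horner_eval x \o map_poly i.
have hX : h 'X = x by rewrite /h /= /horner_eval map_polyX hornerX.
rewrite -hX -(euler_sum h charF) big_mkord; apply: eq_bigr => k _.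
have -> : euler_at (n - k) (h 'X) = h (euler_poly F (n - k)) by rewrite hX.
by rewrite mulrA; congr (_ * _); rewrite mulrAC.
Qed.
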